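(* Let $(M,\omega)$ be an almost symplectic AS-manifold with AS-connection $\tilde\nabla$, and let $\tilde T$ be the torsion of $\tilde\nabla$. Then $(M,\omega)$ is a symplectic manifold (i.e. $d\omega=0$) if and only if $\tilde T$ lies in $\tilde{\mathcal T}_1+\tilde{\mathcal T}_2$.
   Context: An almost symplectic manifold $(M,\omega)$ is a $2n$-dimensional manifold with a nondegenerate $2$-form $\omega$. It is an AS-manifold if it is equipped with an AS-connection, i.e. a linear connection $\tilde\nabla$ with $\tilde\nabla\tilde R=0$, $\tilde\nabla\tilde T=0$, $\tilde\nabla\omega=0$, where $\tilde R,\tilde T$ are its curvature and torsion. The torsion is viewed as a $(0,3)$-tensor by $\tilde T_{XYZ}=\omega(\tilde T_XY,Z)$, so at each $p\in M$ it is an element of $\wedge^2V^*\otimes V^*$ with $V=T_pM$ (skew in $X,Y$). Write $\omega_{XY}=\omega(X,Y)$ and, for a symplectic basis $\{e_1,\dots,e_{2n}\}$ of $V$ ($\omega(e_i,e_{j+n})=\delta_{ij}$, other pairings among $e_1,\dots,e_n$ and among $e_{n+1},\dots,e_{2n}$ zero), $\mathrm t_{12}(\tilde T)(Z)=\sum_{i=1}^n\tilde T_{e_ie_{i+n}Z}$. Define the subspaces of $\wedge^2V^*\otimes V^*$ $$\tilde{\mathcal T}_1(V)=\{\tilde T:\tilde T_{XYZ}=2\omega_{XY}\omega_{ZU}+\omega_{XZ}\omega_{YU}-\omega_{YZ}\omega_{XU},\ U\in V\},$$ $$\tilde{\mathcal T}_2(V)=\{\tilde T:\tilde T_{XYZ}+\tilde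 T_{YZX}+\tilde T_{ZXY}=0,\ \mathrm t_{12}(\tilde T)=0\}.$$ That $\tilde T$ lies in $\tilde{\mathcal T}_1+\tilde{\mathcal T}_2$ means that $\tilde T_p\in\tilde{\mathcal T}_1(T_pM)+\tilde{\mathcal T}_2(T_pM)$ for every $p\in M$. *)

(* Defs.v *)
From HB Require Import structures.
From mathcomp Require Import all_boot all_order all_algebra.
From mathcomp Require Import all_classical all_reals all_analysis.
Set Implicit Arguments.
Unset Strict Implicit.
Unset Printing Implicit Defensive.
Import Order.TTheory GRing.Theory Num.Theory.
Import numFieldNormedType.Exports.
Local Open Scope classical_set_scope.
Local Open Scope ring_scope.

(** * Smooth maps between normed spaces *)

(* Continuity of the k-th derivatives need not be required separately: it
   follows from their differentiability in [Ck k.+1]. *)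
Fixpoint Ck (R : realType) (V W : normedModType R) (k : nat) (A : set V)
    (f : V -> W) : Prop :=
  if k is k'.+1 then
    (forall x, A x -> differentiable f x) /\
    (forall v, Ck k' A (fun x => 'D_v f x))
  else forall x, A x -> {for x, continuous f}.

Definition smooth_on (R : realType) (V W : normedModType R) (A : set V)
  (f : V -> W) : Prop := forall k, Ck k A f.

(** * Smooth manifolds *)

(* [chart_inv] is a total function; only its values on [chart_cod] matter. *)
Record chart (R : realType) (M : topologicalType) (m : nat) := Chart {
  chart_dom : set M;
  chart_map :> M -> 'rV[R]_m;
  chart_inv : 'rV[R]_m -> M;
  chart_dom_open : open chart_dom;
  chart_cod_open : open (chart_map @` chart_dom);
  chart_mapK : forall p, chart_dom p -> chart_inv (chart_map p) = p;
  chart_map_continuous : {within chart_dom, continuous chart_map};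
  chart_inv_continuous :
    {within chart_map @` chart_dom, continuous chart_inv} }.

Definition chart_cod (R : realType) (M : topologicalType) (m : nat)
  (c : chart R M m) : set 'rV[R]_m := c @` chart_dom c.

(* [chart_at p] is a preferred chart around [p], part of the presentation of
   the manifold; it serves to represent tangent vectors (see below). *)
Record manifold (R : realType) (m : nat) := Manifold {
  carrier :> topologicalType;
  atlas : set (chart R carrier m);
  chart_at : carrier -> chart R carrier m;
  manifold_hausdorff : hausdorff_space carrier;
  manifold_second_countable : @second_countable carrier;
  chart_at_atlas : forall p, atlas (chart_at p);
  chart_at_dom : forall p, chart_dom (chart_at p) p;
  transition_smooth : forall c c', atlas c -> atlas c' ->
    smooth_on (c @` (chart_dom c `&` chart_dom c')) (c' \o chart_inv c) }.

Section Calculus.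
Variables (R : realType) (m : nat) (M : manifold R m).

Definition smooth_fun (f : M -> R) : Prop :=
  forall c, atlas c -> smooth_on (chart_cod c) (f \o chart_inv c).

(* The tangent space T_pM is identified with R^m by means of the preferred chart
   at p: the row vector v stands for the tangent vector whose components in
   [chart_at p] are v.  Components in other charts are obtained by applying
   the differential of the coordinate change. *)
Definition tangent (p : M) := 'rV[R]_m.
HB.instance Definition _ (p : M) := NormedModule.on (tangent p).
HB.instance Definition _ (p : M) := Vector.on (tangent p).

Definition to_chart (c : chart R M m) (p : M) (v : tangent p) : 'rV[R]_m :=
  'd (c \o chart_inv (chart_at p)) (chart_at p p) v.

Definition of_chart (c : chart R M m) (p : M) (v : 'rV[R]_m) : tangent p :=
  'd (chart_at p \o chart_inv c) (c p) v.

Definition vector_field := forall p : M, tangent p.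

Definition local_field (c : chart R M m) (X : vector_field) (x : 'rV[R]_m) :
  'rV[R]_m := to_chart c (X (chart_inv c x)).

Definition smooth_vf (X : vector_field) : Prop :=
  forall c, atlas c -> smooth_on (chart_cod c) (local_field c X).

(* X(f) *)
Definition vf_act (X : vector_field) (f : M -> R) (p : M) : R :=
  'D_(X p : 'rV[R]_m) (f \o chart_inv (chart_at p)) (chart_at p p).

End Calculus.

(* Locked for performance only: otherwise failing unification attempts between
   two brackets unfold derivatives down to limits. *)
HB.lock Definition lie (R : realType) (m : nat) (M : manifold R m)
    (X Y : vector_field M) : vector_field M := fun p =>
  let c := chart_at p in
  'D_(to_chart c (X p)) (local_field c Y) (c p) -
  'D_(to_chart c (Y p)) (local_field c X) (c p).

Section Forms.
Variables (R : realType) (m : nat) (M : manifold R m).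
Local Notation vector_field := (vector_field M).

Record two_form := TwoForm {
  form_at :> forall p : M, tangent p -> tangent p -> R;
  form_linear_l : forall p (v : tangent p), scalar (fun u => form_at u v);
  form_linear_r : forall p (u : tangent p), scalar (fun v => form_at u v);
  form_alternating : forall p (u : tangent p), form_at u u = 0;
  form_smooth : forall c, atlas c -> forall u v : 'rV[R]_m,
    smooth_on (chart_cod c) (fun x =>
      form_at (of_chart c (chart_inv c x) u) (of_chart c (chart_inv c x) v)) }.

Definition form_fun (w : two_form) (X Y : vector_field) : M -> R :=
  fun p => w p (X p) (Y p).

Definition nondegenerate_form (w : two_form) : Prop :=
  forall p (u : tangent p), (forall v, w p u v = 0) -> u = 0.

(* Invariant formula for (dw)(X, Y, Z), normalized without the factor 1/3. *)
Definition ext_deriv (w : two_form) (X Y Z : vector_field) (p : M) : R :=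
  vf_act X (form_fun w Y Z) p - vf_act Y (form_fun w X Z) p
  + vf_act Z (form_fun w X Y) p
  - form_fun w (lie X Y) Z p + form_fun w (lie X Z) Y p
  - form_fun w (lie Y Z) X p.

Definition closed_form (w : two_form) : Prop :=
  forall X Y Z, smooth_vf X -> smooth_vf Y -> smooth_vf Z ->
  forall p, ext_deriv w X Y Z p = 0.

(** * Linear connections *)

(* The operator is total, but only constrained on smooth vector fields. *)
Record linear_connection := LinearConnection {
  cov :> vector_field -> vector_field -> vector_field;
  cov_smooth : forall X Y, smooth_vf X -> smooth_vf Y -> smooth_vf (cov X Y);
  cov_addl : forall X X' Y, smooth_vf X -> smooth_vf X' -> smooth_vf Y ->
    forall p, cov (fun q => X q + X' q) Y p = cov X Y p + cov X' Y p;
  cov_scalel : forall f X Y, smooth_fun f -> smooth_vf X -> smooth_vf Y ->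
    forall p, cov (fun q => f q *: X q) Y p = f p *: cov X Y p;
  cov_addr : forall X Y Y', smooth_vf X -> smooth_vf Y -> smooth_vf Y' ->
    forall p, cov X (fun q => Y q + Y' q) p = cov X Y p + cov X Y' p;
  cov_leibniz : forall f X Y, smooth_fun f -> smooth_vf X -> smooth_vf Y ->
    forall p, cov X (fun q => f q *: Y q) p =
              vf_act X f p *: Y p + f p *: cov X Y p }.

Section Connection.
Variable nabla : linear_connection.

Definition torsion (X Y : vector_field) : vector_field := fun p =>
  nabla X Y p - nabla Y X p - lie X Y p.

Definition curvature (X Y Z : vector_field) : vector_field := fun p =>
  nabla X (nabla Y Z) p - nabla Y (nabla X Z) p - nabla (lie X Y) Z p.

Definition parallel_torsion : Prop :=
  forall W X Y, smooth_vf W -> smooth_vf X -> smooth_vf Y -> forall p,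
  nabla W (torsion X Y) p - torsion (nabla W X) Y p - torsion X (nabla W Y) p
  = 0.

Definition parallel_curvature : Prop :=
  forall W X Y Z,
  smooth_vf W -> smooth_vf X -> smooth_vf Y -> smooth_vf Z -> forall p,
  nabla W (curvature X Y Z) p - curvature (nabla W X) Y Z p
  - curvature X (nabla W Y) Z p - curvature X Y (nabla W Z) p = 0.

Definition parallel_form (w : two_form) : Prop :=
  forall W X Y, smooth_vf W -> smooth_vf X -> smooth_vf Y -> forall p,
  vf_act W (form_fun w X Y) p - form_fun w (nabla W X) Y p
  - form_fun w X (nabla W Y) p = 0.

(* [t] is the value at [p] of the (0,3)-tensor field
   (X, Y, Z) |-> w(torsion X Y, Z). *)
Definition torsion_tensor_at (w : two_form) (p : M)
    (t : tangent p -> tangent p -> tangent p -> R) : Prop :=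
  forall X Y Z, smooth_vf X -> smooth_vf Y -> smooth_vf Z ->
  t (X p) (Y p) (Z p) = w p (torsion X Y p) (Z p).

End Connection.

Definition AS_connection (w : two_form) (nabla : linear_connection) : Prop :=
  [/\ parallel_curvature nabla, parallel_torsion nabla
    & parallel_form nabla w].

End Forms.

(** * The spaces T1(V) and T2(V) of a symplectic vector space *)

Section TorsionSpaces.
Variables (R : realType) (V : vectType R) (n : nat) (w : V -> V -> R).

Definition symplectic_basis (e : 'I_(n + n) -> V) : Prop :=
  [/\ basis_of fullv [seq e i | i : 'I_(n + n)],
      forall i j, w (e (lshift n i)) (e (rshift n j)) = (i == j)%:R,
      forall i j, w (e (lshift n i)) (e (lshift n j)) = 0
    & forall i j, w (e (rshift n i)) (e (rshift n j)) = 0].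

(* The space Lambda^2 V^* (x) V^*. *)
Definition skew_trilinear : set (V -> V -> V -> R) := [set t |
  [/\ forall Y Z, scalar (fun X => t X Y Z),
      forall X Z, scalar (fun Y => t X Y Z),
      forall X Y, scalar (fun Z => t X Y Z)
    & forall X Y Z, t X Y Z = - t Y X Z]].

Definition t12 (e : 'I_(n + n) -> V) (t : V -> V -> V -> R) (Z : V) : R :=
  \sum_(i < n) t (e (lshift n i)) (e (rshift n i)) Z.

Definition torsion1 : set (V -> V -> V -> R) := [set t |
  skew_trilinear t /\
  exists U, forall X Y Z,
    t X Y Z = 2 * w X Y * w Z U + w X Z * w Y U - w Y Z * w X U].

(* The contraction [t12 e] does not depend on the symplectic basis [e], and
   such bases exist as soon as w is symplectic and dim V = 2n. *)
Definition torsion2 : set (V -> V -> V -> R) := [set t |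
  [/\ skew_trilinear t,
      forall X Y Z, t X Y Z + t Y Z X + t Z X Y = 0
    & forall e, symplectic_basis e -> forall Z, t12 e t Z = 0]].

Definition torsion12 : set (V -> V -> V -> R) := [set t |
  exists t1 t2, [/\ torsion1 t1, torsion2 t2 &
    forall X Y Z, t X Y Z = t1 X Y Z + t2 X Y Z]].

End TorsionSpaces.

(* Main.v *)
Require Import Defs.
From HB Require Import structures.
From mathcomp Require Import all_boot all_order all_algebra ring lra.
From mathcomp Require Import all_classical all_reals all_analysis.
Set Implicit Arguments.
Unset Strict Implicit.
Unset Printing Implicit Defensive.
Import Order.TTheory GRing.Theory Num.Theory.
Import numFieldNormedType.Exports.
Local Open Scope classical_set_scope.
Local Open Scope ring_scope.

(* Since the connection preserves omega, the invariant formula for d omega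
   collapses to the cyclic sum of omega(T(X, Y), Z).  A tensor of the form T1
   or T2 has vanishing cyclic sum.  Conversely, torsion is tensorial (which
   needs bump functions, as the connection is only an operator on global
   fields), and a tensor t with vanishing cyclic sum splits: the T1 tensor of U
   has contraction t12 equal to (2n + 1) omega(Z, U), so U can be chosen such
   that t minus this tensor has zero contraction. *)

(** * Iterated differentiability *)

(** The theorem speaks of a tensor on each tangent space, while [torsion] takes global fields. The
    tensor is obtained by extending every tangent vector to some global smooth field, and
    tensoriality makes this choice immaterial. Both steps need chart data, cut off by a bump
    function, to extend smoothly by zero to all of [M]. This holds because the support is a compact
    set inside the chart, hence closed as [M] is Hausdorff. The bump itself comes from exp(-1/x),
    and since [Ck] is an iterated condition on directional derivatives, its stability under sums,
    products and composition has to be established by induction on the order. *)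

(** The first-order expansion of [f] at [x] depends only on the germ of [f], so it is also one for
    [g], with the same linear part. *)
Lemma near_eq_differentiable (R : numFieldType) (V W : normedModType R)
    (f g : V -> W) (x : V) :
  (\near x, f x = g x) -> differentiable f x -> differentiable g x.
Proof.
move=> fg df.
have E : g \o shift x = cst (g x) + 'd f x +o_ 0 id.
  apply/eqaddoP => e e0.
  have /eqaddoP/(_ e e0) := diff_locally df.
  have fgs : \forall h \near 0, f (h + x) = g (h + x).
    have := fg; rewrite (near_shift 0 x).
    by apply: filterS => h /=; rewrite subr0.
  apply: filterS2 fgs => h /= fgh.
  rewrite !fctE /= -fgh.
  by rewrite -(nbhs_singleton fg).
apply/diff_locallyP.
rewrite (diff_unique (diff_continuous df) E); split => //.
exact: diff_continuous.
Qed.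

Section CkTheory.
Variable R : realType.
Implicit Types V W U : normedModType R.

(** Openness of [A] turns equality on [A] into equality of germs, which passes to derivatives. *)
Lemma Ck_ext V W k (A : set V) (f g : V -> W) :
  open A -> (forall x, A x -> f x = g x) -> Ck k A f -> Ck k A g.
Proof.
move=> oA; elim: k f g => [|k IH] f g fg /=.
  move=> cf x Ax; have nfg : \near x, f x = g x.
    by apply: filterS (open_nbhs_nbhs (conj oA Ax)) => y /fg.
  have fgx : f @ x --> g x by rewrite -(fg x Ax); exact: cf.
  by apply: cvg_trans fgx; apply: near_eq_cvg.
have nfg x : A x -> \near x, f x = g x.
  by move=> Ax; apply: filterS (open_nbhs_nbhs (conj oA Ax)) => y /fg.
move=> [df Df]; split=> [x Ax|v].
  exact: near_eq_differentiable (nfg x Ax) (df x Ax).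
apply: (IH (fun x => 'D_v f x)) => // x Ax.
exact/near_eq_derive/nfg.
Qed.

Lemma Ck_sub V W k (A B : set V) (f : V -> W) :
  A `<=` B -> Ck k B f -> Ck k A f.
Proof.
move=> AB; elim: k f => [|k IH] f /=; first by move=> cf x /AB; exact: cf.
by move=> [df Df]; split=> [x /AB|v]; [exact: df|exact: IH].
Qed.

(** The sets [B] need not be open: [Ck] is a pointwise condition on the iterated derivatives of the
    total function [f]. *)
Lemma Ck_local V W k (A : set V) (f : V -> W) :
  (forall x, A x -> exists B : set V, [/\ B x & Ck k B f]) -> Ck k A f.
Proof.
elim: k f => [|k IH] f H /=; first by move=> x /H[B [Bx]]; exact.
split=> [x /H[U [Ux [df _]]]|v]; first exact: df.
by apply: IH => x /H[U [Ux [_ /(_ v)]]]; exists U.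
Qed.

Lemma CkW V W k (A : set V) (f : V -> W) : Ck k.+1 A f -> Ck k A f.
Proof.
elim: k f => [|k IH] f [df Df] /=; last first.
  by split=> // v; apply: (IH (fun x => 'D_v f x)); exact: Df.
by move=> x Ax; apply: differentiable_continuous; exact: df.
Qed.

Lemma Ck_cst V W k (A : set V) (a : W) : Ck k A (fun=> a).
Proof.
elim: k a => [|k IH] a /=; first by move=> x _; exact: cvg_cst.
split=> [x _|v]; first exact: differentiable_cst.
have -> : (fun x : V => 'D_v (fun=> a) x) = (fun=> 0 : W).
  by apply/funext => x; exact: derive_cst.
exact: IH.
Qed.

Lemma CkD V W k (A : set V) (f g : V -> W) : open A ->
  Ck k A f -> Ck k A g -> Ck k A (fun x => f x + g x).
Proof.
move=> oA; elim: k f g => [|k IH] f g /=.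
  by move=> cf cg x Ax; apply: cvgD; [exact: cf|exact: cg].
move=> [df Df] [dg Dg]; split=> [x Ax|v].
  by apply: differentiableD; [exact: df|exact: dg].
apply: (@Ck_ext _ _ _ _ (fun x => 'D_v f x + 'D_v g x)) => //; last exact: IH.
move=> x Ax; rewrite -deriveD//; apply: diff_derivable; [exact: df|exact: dg].
Qed.

Lemma Ck_sum V W k (A : set V) (I : Type) (r : seq I) (P : pred I)
    (f : I -> V -> W) : open A ->
  (forall i, Ck k A (f i)) -> Ck k A (fun x => \sum_(i <- r | P i) f i x).
Proof.
move=> oA Cf; elim: r => [|i r IH].
  apply: (@Ck_ext _ _ _ _ (fun=> 0)) => //; last exact: Ck_cst.
  by move=> x _; rewrite big_nil.
case Pi: (P i).
  apply: (@Ck_ext _ _ _ _ (fun x => f i x + \sum_(i <- r | P i) f i x)) => //.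
    by move=> x _; rewrite big_cons Pi.
  exact: CkD.
by apply: Ck_ext IH => // x _; rewrite big_cons Pi.
Qed.

Lemma scale_is_bilinear (W : normedModType R) :
  bilinear_for
    (GRing.Scale.Law.clone _ _ *:%R _) (GRing.Scale.Law.clone _ _ *:%R _)
    (@GRing.scale R W).
Proof.
split=> [u'|u] a x y /=.
- by rewrite scalerDl scalerA.
- by rewrite scalerDr !scalerA mulrC.
Qed.

(** The product rule is the chain rule for the pair [(f, g)] followed by the continuous bilinear map
    [*:%R]. *)
Lemma is_diff_scale V W (f : V -> R) (g : V -> W) x :
  differentiable f x -> differentiable g x ->
  is_diff x (fun y => f y *: g y) (fun v => f x *: 'd g x v + 'd f x v *: g x).
Proof.
move=> df dg.
pose sM := bilinear_isBilinear.Build R R W W _ _ _ (@scale_is_bilinear W).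
pose s : {bilinear R -> W -> W} := HB.pack (@GRing.scale R W) sM.
have sc : continuous (fun p => s p.1 p.2) by move=> p; exact: scale_continuous.
have ds := differentiable_bilin (f x, g x) sc.
have dp := differentiable_pair df dg.
apply: DiffDef; first exact: (differentiable_comp dp ds).
rewrite (diff_comp dp ds) diff_bilin// diff_pair//.
Qed.

Lemma derive_scale V W (f : V -> R) (g : V -> W) x v :
  differentiable f x -> differentiable g x ->
  'D_v (fun x => f x *: g x) x = 'D_v f x *: g x + f x *: 'D_v g x.
Proof.
move=> df dg; have H := is_diff_scale df dg.
rewrite (deriveE _ df) (deriveE _ dg) (deriveE _ (@ex_diff _ _ _ _ _ _ _ H)).
by rewrite (@diff_val _ _ _ _ _ _ _ H) addrC.
Qed.

Lemma CkZ V W k (A : set V) (f : V -> R) (g : V -> W) : open A ->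
  Ck k A f -> Ck k A g -> Ck k A (fun x => f x *: g x).
Proof.
move=> oA; elim: k f g => [|k IH] f g.
  by move=> cf cg x Ax; apply: cvgZ; [exact: cf|exact: cg].
move=> Cf Cg; have [[df Df] [dg Dg]] := (Cf, Cg); split=> [x Ax|v].
  exact: (@ex_diff _ _ _ _ _ _ _ (is_diff_scale (df x Ax) (dg x Ax))).
apply: (@Ck_ext _ _ _ _
  (fun x => 'D_v f x *: g x + f x *: 'D_v g x)) => //.
  by move=> x Ax; rewrite derive_scale//; [exact: df|exact: dg].
by apply: CkD => //; apply: IH; [exact: Df|exact: CkW|exact: CkW|exact: Dg].
Qed.

Lemma Ck_linear V W k (A : set V) (f : {linear V -> W}) :
  continuous f -> Ck k A f.
Proof.
move=> cf; case: k => [|k]; first by move=> x _; exact: cf.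
split=> [x _|v]; first exact: linear_differentiable.
have -> : (fun x : V => 'D_v f x) = (fun=> f v : W).
  apply/funext => x; rewrite deriveE ?diff_lin//.
  exact: linear_differentiable.
exact: Ck_cst.
Qed.

Lemma Ck_linear_comp V W U k (A : set V) (f : V -> W) (L : {linear W -> U}) :
  open A -> continuous L -> Ck k A f -> Ck k A (fun x => L (f x)).
Proof.
move=> oA cL; elim: k f => [|k IH] f.
  by move=> cf x Ax; apply: continuous_comp; [exact: cf|exact: cL].
move=> [df Df]; split=> [x Ax|v].
  apply: differentiable_comp; first exact: df.
  exact: linear_differentiable.
apply: (@Ck_ext _ _ _ _ (fun x => L ('D_v f x))) => //; last first.
  by apply: IH; exact: Df.
move=> x Ax; have dL := linear_differentiable (f x) cL.
rewrite [RHS]deriveE; last by apply: differentiable_comp => //; exact: df.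
rewrite (diff_comp (df _ Ax) dL) /= diff_lin// deriveE//; exact: df.
Qed.

(* The derivatives of [g \o f] are expanded in partial derivatives of [g], which
   is why the intermediate space has finitely many coordinates. *)
Lemma Ck_comp_coord V W U (I : finType) (b : I -> W) (l : I -> {linear W -> R})
    k (A : set V) (B : set W) (f : V -> W) (g : W -> U) :
  (forall i, continuous (l i)) -> (forall y, y = \sum_i l i y *: b i) ->
  open A -> (forall x, A x -> B (f x)) ->
  Ck k A f -> Ck k B g -> Ck k A (fun x => g (f x)).
Proof.
move=> lc lE oA AB; elim: k g => [|k IH] g.
  by move=> cf cg x Ax; apply: continuous_comp; [exact: cf|exact/cg/AB].
move=> Cf Cg; have [[df Df] [dg Dg]] := (Cf, Cg); split=> [x Ax|v].
  by apply: differentiable_comp; [exact: df|exact/dg/AB].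
apply: (@Ck_ext _ _ _ _
  (fun x => \sum_i l i ('D_v f x) *: 'D_(b i) g (f x))) => //.
  move=> x Ax; have [dfx dgx] := (df _ Ax, dg _ (AB _ Ax)).
  rewrite [RHS]deriveE; last exact: differentiable_comp.
  rewrite (diff_comp dfx dgx) /= -(deriveE v dfx) [in RHS](lE ('D_v f x)).
  rewrite linear_sum; apply: eq_bigr => i _.
  by rewrite linearZ/= -(deriveE (b i) dgx).
apply: Ck_sum => // i; apply: CkZ => //.
  exact: (Ck_linear_comp oA (lc i) (Df v)).
by apply: (IH (fun y => 'D_(b i) g y)); [exact: CkW|exact: Dg].
Qed.

End CkTheory.

(** * A flat function and bump functions *)

Section Flat.
Variable R : realType.

(** The powers of 1/x make the family stable under differentiation, up to linear combinations, so
    that all its members are shown smooth in one induction. The bump function uses only [k = 0]. *)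
Definition flat (k : nat) (x : R) : R :=
  if 0 < x then x^-1 ^+ k * expR (- x^-1) else 0.

Lemma flat_ge0 k x : 0 <= flat k x.
Proof.
rewrite /flat; case: ifP => // x0.
by rewrite mulr_ge0 ?expR_ge0// exprn_ge0// invr_ge0 ltW.
Qed.

Lemma flat_gt0 k x : 0 < x -> 0 < flat k x.
Proof.
by move=> x0; rewrite /flat x0 mulr_gt0 ?expR_gt0// exprn_gt0// invr_gt0.
Qed.

Lemma flat_le0 k x : x <= 0 -> flat k x = 0.
Proof. by move=> x0; rewrite /flat ltNge x0. Qed.

(** For s = 1/x > 0 the exponential series gives exp(s) >= s^(k+1) / (k+1)!, one power more than the
    factor s^k to be absorbed. *)
Lemma flat_bound k x : flat k x <= k.+1`!%:R * `|x|.
Proof.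
have [x0|x0] := ltP 0 x; last by rewrite flat_le0// mulr_ge0.
rewrite /flat x0 gtr0_norm// expRN ler_pdivrMr ?expR_gt0//.
have s0 : 0 < x^-1 by rewrite invr_gt0.
have := expR_ge1Dxn k (ltW s0) => H.
have {H} : x^-1 ^+ k.+1 / k.+1`!%:R <= expR x^-1 by lra.
rewrite ler_pdivrMr ?ltr0n ?fact_gt0// exprSr ler_pdivrMr//.
by move=> H; apply: le_trans H _; rewrite le_eqVlt; apply/orP; left;
  apply/eqP; ring.
Qed.

Lemma flat_div k x : x^-1 * flat k x = flat k.+1 x.
Proof. by rewrite /flat; case: ifP => _; rewrite ?mulr0// mulrA -exprS. Qed.

Lemma is_derive_flat k (x : R) :
  is_derive x 1 (flat k) (flat k.+2 x - k%:R * flat k.+1 x).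
Proof.
have [x0|x0|<-] := ltgtP 0 x.
- pose g (y : R) := y^-1 ^+ k * expR (- y^-1).
  have gE : \near x, g x = flat k x.
    have := lt_nbhsr x0.
    by apply: filterS => y; rewrite /= /flat => ->.
  apply: (near_eq_is_derive gE).
  have xn0 : x != 0 by rewrite gt_eqF.
  have dV : is_derive x 1 (fun y : R => y^-1) (- x ^- 2).
    have := @is_deriveV R id x 1 1 xn0 _; rewrite /= => /(_ (is_derive_id _ _)).
    by rewrite [_ *: _]mulr1.
  have dE : is_derive x 1 (fun y => expR (- y^-1)) (expR (- x^-1) * x ^- 2).
    have dN : is_derive x 1 (fun y => - y^-1) (x ^- 2).
      by have := is_deriveN dV; rewrite opprK.
    exact: (@is_derive1_comp _ expR (fun y => - y^-1)).
  have dX := @is_deriveX _ _ (fun y : R => y^-1) k x 1 _ dV.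
  have -> : g = (fun y => y^-1) ^+ k * (fun y => expR (- y^-1)).
    by apply/funext => y; rewrite /g !fctE.
  apply: (is_derive_eq (is_deriveM dX dE)).
  rewrite /flat x0 exprfctE /= /GRing.scale /=.
  case: k {g gE dX} => [|k].
    by rewrite !mul0r mulr0 subr0 addr0 expr0 !mul1r mulrC exprVn.
  by rewrite -!exprVn !exprS /=; ring.
- apply: (@near_eq_is_derive _ _ _ (cst 0)).
    have := lt_nbhsl x0.
    by apply: filterS => y /= y0; rewrite flat_le0// ltW.
  by rewrite !flat_le0 ?ltW// mulr0 subr0; exact: is_derive_cst.
(* At the origin the difference quotient of [flat k] is [flat k.+1], which [flat_bound] forces to
   tend to 0. *)
- rewrite !flat_le0// mulr0 subr0.
  have H : (fun h => h^-1 *: ((flat k \o shift 0) (h *: 1) - flat k 0)) @ 0^'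
      --> (0 : R).
    apply/cvgr0Pnorm_le => e e0; near=> h.
    rewrite /= addr0 [h *: 1]mulr1 (flat_le0 k (lexx 0)) subr0 [_ *: _]flat_div.
    rewrite ger0_norm ?flat_ge0//; apply: le_trans (flat_bound _ _) _.
    rewrite mulrC -ler_pdivlMr ?ltr0n ?fact_gt0//.
    near: h; apply: dnbhs0_le; rewrite divr_gt0// ltr0n fact_gt0//.
  apply: DeriveDef; first by apply/cvg_ex; exists 0.
  exact: cvg_lim H.
Unshelve. all: by end_near. Qed.

Lemma flat_smooth k j : Ck j [set: R] (flat k).
Proof.
elim: j k => [|j IH] k.
  move=> x _; apply/differentiable_continuous/derivable1_diffP.
  by have [] := is_derive_flat k x.
split=> [x _|v].
  by apply/derivable1_diffP; have [] := is_derive_flat k x.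
apply: (@Ck_ext _ _ _ _ _
  (fun x => v *: (flat k.+2 x + (- k%:R) *: flat k.+1 x))).
- exact: openT.
- move=> x _; have d := is_derive_flat k x.
  have df : differentiable (flat k) x by apply/derivable1_diffP; case: d.
  rewrite deriveE// -[in RHS](mulr1 v) [RHS]linearZ -deriveE//.
  by rewrite (@derive_val _ _ _ _ _ _ _ d) scaleNr.
- apply: CkZ; [exact: openT|exact: Ck_cst|].
  apply: CkD; [exact: openT|exact: IH|].
  by apply: CkZ; [exact: openT|exact: Ck_cst|exact: IH].
Qed.

End Flat.

(** * Charts and extension by zero *)

Definition row_coord (R : realType) (m : nat) (i : 'I_m) (v : 'rV[R]_m) : R :=
  v 0 i.

Lemma row_coord_linear (R : realType) (m : nat) (i : 'I_m) :
  linear (@row_coord R m i : 'rV[R]_m -> R).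
Proof. by move=> a u v; rewrite /row_coord !mxE. Qed.

HB.instance Definition _ (R : realType) (m : nat) (i : 'I_m) :=
  GRing.isLinear.Build _ _ _ _ _ (@row_coord_linear R m i).

Lemma row_coord_continuous (R : realType) (m : nat) (i : 'I_m) :
  continuous (@row_coord R m i).
Proof. exact: coord_continuous. Qed.

(** * Composition through row vectors and cut-off functions on them *)

Section SmoothMapsOfRows.
Variable R : realType.
Implicit Types V W U : normedModType R.

Lemma Ck_comp_rV V U m k (A : set V) (B : set 'rV[R]_m) (f : V -> 'rV[R]_m)
    (g : 'rV[R]_m -> U) : open A -> (forall x, A x -> B (f x)) ->
  Ck k A f -> Ck k B g -> Ck k A (fun x => g (f x)).
Proof.
apply: (@Ck_comp_coord _ _ _ _ _ (fun i : 'I_m => delta_mx 0 i)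
  (@row_coord R m)); first exact: row_coord_continuous.
exact: row_sum_delta.
Qed.

Lemma Ck_comp_R V U k (A : set V) (B : set R) (f : V -> R) (g : R -> U) :
  open A -> (forall x, A x -> B (f x)) ->
  Ck k A f -> Ck k B g -> Ck k A (fun x => g (f x)).
Proof.
apply: (@Ck_comp_coord _ _ _ _ unit (fun=> 1 : R) (fun=> idfun)) => //.
  by move=> _ x.
by move=> y; rewrite big_const card_unit /= addr0 [RHS]mulr1.
Qed.

Lemma Ck_row_coord m k (A : set 'rV[R]_m) i : Ck k A (@row_coord R m i).
Proof. exact/Ck_linear/row_coord_continuous. Qed.

(* The cut-off uses the Euclidean norm, whose balls lie in those of the maximum
   norm of ['rV]. *)
Lemma bump_exists m (a : 'rV[R]_m) (r : R) : 0 < r ->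
  exists f : 'rV[R]_m -> R, [/\ smooth_on [set: 'rV[R]_m] f, f a != 0 &
    forall x, ~ closed_ball a r x -> f x = 0].
Proof.
move=> r0.
pose q (x : 'rV[R]_m) := r ^+ 2 - \sum_i (x 0 i - a 0 i) ^+ 2.
have qs : smooth_on [set: 'rV[R]_m] q.
  move=> k.
  pose s i (x : 'rV[R]_m) : R := row_coord i x + (- a 0 i).
  have sC i : Ck k [set: 'rV[R]_m] (s i).
    by apply: CkD; [exact: openT|exact: Ck_row_coord|exact: Ck_cst].
  apply: (@Ck_ext _ _ _ _ _
    (fun x => r ^+ 2 + (-1 : R) *: \sum_i s i x *: s i x)).
  - exact: openT.
  - move=> x _; rewrite /q scaleN1r; congr (_ - _).
  - apply: CkD; [exact: openT|exact: Ck_cst|].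
    apply: CkZ; [exact: openT|exact: Ck_cst|].
    apply: Ck_sum; first exact: openT.
    by move=> i; apply: CkZ; [exact: openT|exact: sC|exact: sC].
exists (fun x => flat 0 (q x)); split.
- by move=> k; apply: (Ck_comp_R openT _ (qs k) (@flat_smooth R 0 k)).
- rewrite gt_eqF// flat_gt0// /q big1 ?subr0 ?exprn_gt0// => i _.
  by rewrite subrr expr0n.
- move=> x nx; apply: flat_le0; rewrite leNgt; apply/negP => qx0; apply: nx.
  rewrite closed_ballE// /closed_ball_ /=.
  rewrite /Num.norm /= mx_normrE; apply/bigmax_leP; split; first exact: ltW.
  move=> [j i] _ /=; rewrite (ord1 j) !mxE.
  suff : `|a 0 i - x 0 i : R| <= r by [].
  rewrite -(@ler_pXn2r _ 2) ?nnegrE ?(ltW r0)// real_normK ?num_real// ltW//.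
  move: qx0; rewrite /q subr_gt0; apply: le_lt_trans.
  rewrite (bigD1 i)//= -sqrrN opprB lerDl.
  by apply: sumr_ge0 => l _; exact: sqr_ge0.
Qed.

End SmoothMapsOfRows.

Section Charts.
Variables (R : realType) (m : nat) (M : manifold R m).
Implicit Types (c : chart R M m) (p : M).

Lemma chart_cod_in c p : chart_dom c p -> chart_cod c (c p).
Proof. by move=> cp; exists p. Qed.

Lemma chart_inv_dom c x : chart_cod c x -> chart_dom c (chart_inv c x).
Proof. by move=> [p cp <-]; rewrite chart_mapK. Qed.



(** Continuity of [chart_inv] is known only within [chart_cod]; as that set is open, relative
    openness is openness. *)
Lemma chart_cod_preimage_open c (O : set M) : open O ->
  open (chart_cod c `&` [set x | O (chart_inv c x)]).
Proof.
move=> oO; have := @chart_inv_continuous _ _ _ c.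
rewrite continuous_open_subspace; last exact: chart_cod_open.
move=> ic; rewrite openE => x [cx Ox]; rewrite /interior.
apply: filterI.
  by apply: open_nbhs_nbhs; split=> //; exact: chart_cod_open.
by apply: ic; [exact/mem_set|exact: open_nbhs_nbhs].
Qed.

Lemma transition_domE c c' : c @` (chart_dom c `&` chart_dom c') =
  chart_cod c `&` [set x | chart_dom c' (chart_inv c x)].
Proof.
apply/seteqP; split=> x /=.
  by move=> [p [cp c'p] <-]; rewrite chart_mapK//; split=> //; exists p.
by move=> [[p cp <-]]; rewrite chart_mapK// => c'p; exists p.
Qed.

Lemma transition_dom_open c c' : open (c @` (chart_dom c `&` chart_dom c')).
Proof.
rewrite transition_domE; apply: chart_cod_preimage_open.
exact: chart_dom_open.
Qed.

Lemma transition_dom_nbhs c c' p : chart_dom c p -> chart_dom c' p ->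
  nbhs (c p) (c @` (chart_dom c `&` chart_dom c')).
Proof.
move=> cp c'p; apply: open_nbhs_nbhs; split; first exact: transition_dom_open.
by exists p.
Qed.

Lemma transition_differentiable c c' p : atlas c -> atlas c' ->
  chart_dom c p -> chart_dom c' p ->
  differentiable (c' \o chart_inv c) (c p).
Proof.
move=> ac ac' cp c'p; have [+ _] := transition_smooth ac ac' 1.
by apply; exists p.
Qed.

Lemma near_eq_diff (V W : normedModType R) (f g : V -> W) x v :
  (\near x, f x = g x) -> differentiable f x -> 'd f x v = 'd g x v.
Proof.
move=> fg df.
rewrite -(deriveE v df) -(deriveE v (near_eq_differentiable fg df)).
exact: near_eq_derive.
Qed.

Lemma diff_comp_at (U V W : normedModType R) (f : U -> V) (g : V -> W) x y v :
  f x = y -> differentiable f x -> differentiable g y ->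
  differentiable (g \o f) x /\ 'd (g \o f) x v = 'd g y ('d f x v).
Proof.
move=> <- df dg; split; first exact: differentiable_comp.
by rewrite diff_comp.
Qed.

(** The cocycle rule for coordinate changes. The composite of the two transitions equals the direct
    one only on the overlap of [c] and [c'], so the chain rule is combined with invariance of the
    differential under equality of germs. *)
Lemma transition_diff_comp c c' c'' p v : atlas c -> atlas c' -> atlas c'' ->
  chart_dom c p -> chart_dom c' p -> chart_dom c'' p ->
  'd (c'' \o chart_inv c') (c' p) ('d (c' \o chart_inv c) (c p) v) =
  'd (c'' \o chart_inv c) (c p) v.
Proof.
move=> ac ac' ac'' cp c'p c''p.
have d1 := transition_differentiable ac ac' cp c'p.
have d2 := transition_differentiable ac' ac'' c'p c''p.
have E : (c' \o chart_inv c) (c p) = c' p by rewrite /= chart_mapK.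
have [d3 d3E] := diff_comp_at v E d1 d2.
transitivity ('d ((c'' \o chart_inv c') \o (c' \o chart_inv c)) (c p) v).
  exact: esym d3E.
apply: near_eq_diff d3.
apply: filterS (transition_dom_nbhs cp c'p) => _ [q [cq c'q] <-] /=.
by rewrite !chart_mapK.
Qed.

Lemma transition_diff_id c p v : atlas c -> chart_dom c p ->
  'd (c \o chart_inv c) (c p) v = v.
Proof.
move=> ac cp; transitivity ('d (@id 'rV[R]_m) (c p) v).
  apply: near_eq_diff (transition_differentiable ac ac cp cp).
  by apply: filterS (transition_dom_nbhs cp cp) => _ [q [cq _] <-] /=;
    rewrite chart_mapK.
by rewrite (@diff_val _ _ _ _ _ _ _ (is_diff_id _)).
Qed.

Lemma to_chart_of_chart c c' p v : atlas c -> atlas c' ->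
  chart_dom c p -> chart_dom c' p ->
  to_chart c' (of_chart c p v) = 'd (c' \o chart_inv c) (c p) v.
Proof.
move=> ac ac' cp c'p; apply: transition_diff_comp => //.
  exact: chart_at_atlas.
exact: chart_at_dom.
Qed.

Lemma to_chartK c p (v : tangent p) : atlas c -> chart_dom c p ->
  of_chart c p (to_chart c v) = v.
Proof.
move=> ac cp; have [ap dp] := (chart_at_atlas p, chart_at_dom p).
exact: etrans (transition_diff_comp v ap ac ap dp cp dp)
  (transition_diff_id v ap dp).
Qed.

Lemma to_chart_at p (v : tangent p) : to_chart (chart_at p) v = v.
Proof.
by apply: transition_diff_id; [exact: chart_at_atlas|exact: chart_at_dom].
Qed.

Lemma of_chart_at p v : of_chart (chart_at p) p v = v.
Proof.
by apply: transition_diff_id; [exact: chart_at_atlas|exact: chart_at_dom].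
Qed.

Lemma to_chart0 c p : to_chart c (0 : tangent p) = 0.
Proof. exact: linear0. Qed.

Lemma of_chart0 c p : of_chart c p 0 = 0.
Proof. exact: linear0. Qed.

Section ExtendByZero.
Variables (c : chart R M m) (K : set M).
Hypotheses (ac : atlas c) (K_closed : closed K).
Hypothesis K_dom : K `<=` chart_dom c.

Definition supported (T : zmodType) (g : 'rV[R]_m -> T) :=
  forall p, chart_dom c p -> ~ K p -> g (c p) = 0.

Definition extend_fun (g : 'rV[R]_m -> R) (p : M) : R :=
  if pselect (chart_dom c p) then g (c p) else 0.

Definition extend_vf (G : 'rV[R]_m -> 'rV[R]_m) : vector_field M := fun p =>
  if pselect (chart_dom c p) then of_chart c p (G (c p)) else 0.

(** Since [K] lies in the domain of [c], that domain and the complement of [K] cover [M]. On the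
    second set, open because [K] is closed, [F] vanishes. *)
Lemma Ck_extend (W : normedModType R) k c' (F : 'rV[R]_m -> W) :
  Ck k (c' @` (chart_dom c' `&` chart_dom c)) F ->
  (forall x, chart_cod c' x -> ~ K (chart_inv c' x) -> F x = 0) ->
  Ck k (chart_cod c') F.
Proof.
move=> CF F0; apply: Ck_local => x c'x.
have [cx|ncx] := pselect (chart_dom c (chart_inv c' x)).
  by exists (c' @` (chart_dom c' `&` chart_dom c)); rewrite {1}transition_domE.
have oB := chart_cod_preimage_open (closed_openC K_closed) (c := c').
exists (chart_cod c' `&` [set x | (~` K) (chart_inv c' x)]); split.
  by split=> //= /K_dom.
apply: (@Ck_ext _ _ _ _ _ (fun=> 0)); [exact: oB| |exact: Ck_cst].
by move=> y [c'y nKy]; rewrite F0.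
Qed.

Lemma extend_fun_smooth g : smooth_on (chart_cod c) g -> supported g ->
  smooth_fun (extend_fun g).
Proof.
move=> gs gK c' ac' k; have oT := @transition_dom_open c' c.
apply: Ck_extend; last first.
  move=> x c'x nKx; rewrite /extend_fun /=; case: pselect => // cx.
  exact: gK.
apply: (@Ck_ext _ _ _ _ _ (fun y => g ((c \o chart_inv c') y))).
- exact: oT.
- move=> y; rewrite transition_domE => -[c'y cy] /=.
  by rewrite /extend_fun; case: pselect.
- apply: (Ck_comp_rV oT _ (transition_smooth ac' ac k) (gs k)).
  by move=> y; rewrite transition_domE => -[c'y cy]; exact: chart_cod_in.
Qed.

Lemma extend_fun_in g p : chart_dom c p -> extend_fun g p = g (c p).
Proof. by move=> cp; rewrite /extend_fun; case: pselect. Qed.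

Lemma extend_fun_out g p : ~ chart_dom c p -> extend_fun g p = 0.
Proof. by move=> cp; rewrite /extend_fun; case: pselect. Qed.

Lemma extend_vf_in G p : chart_dom c p ->
  extend_vf G p = of_chart c p (G (c p)).
Proof. by move=> cp; rewrite /extend_vf; case: pselect. Qed.

Lemma extend_vf_out G p : ~ chart_dom c p -> extend_vf G p = 0.
Proof. by move=> cp; rewrite /extend_vf; case: pselect. Qed.

Lemma extend_vf_smooth G : smooth_on (chart_cod c) G -> supported G ->
  smooth_vf (extend_vf G).
Proof.
move=> Gs GK c' ac' k; have oT := @transition_dom_open c' c.
apply: Ck_extend; last first.
  move=> x c'x nKx; rewrite /local_field.
  have [cx|ncx] := pselect (chart_dom c (chart_inv c' x)).
    by rewrite (extend_vf_in G cx) (GK _ cx nKx) of_chart0 to_chart0.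
  by rewrite (extend_vf_out G ncx) to_chart0.
(* In [c'] the field is the differential of the transition applied to [G]; expanding [G] in the
   standard basis turns it into partial derivatives of the transition with smooth coefficients. *)
pose H z := \sum_i row_coord i (G z) *:
  'D_(delta_mx 0 i : 'rV[R]_m) (c' \o chart_inv c) z.
apply: (@Ck_ext _ _ _ _ _ (fun y => H ((c \o chart_inv c') y))).
- exact: oT.
- move=> y; rewrite transition_domE => -[c'y cy] /=.
  have dc'y := chart_inv_dom c'y.
  rewrite /local_field (extend_vf_in G cy) (to_chart_of_chart _ ac ac' cy dc'y).
  have dt := transition_differentiable ac ac' cy dc'y.
  rewrite [in RHS](row_sum_delta (G (c (chart_inv c' y)))) linear_sum.
  by apply: eq_bigr => i _; rewrite linearZ/= (deriveE _ dt).
- have oT' := @transition_dom_open c c'.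
  apply: (@Ck_comp_rV _ _ _ _ _ _ (c @` (chart_dom c `&` chart_dom c'))).
  + exact: oT.
  + move=> y; rewrite transition_domE => -[c'y cy].
    by exists (chart_inv c' y) => //; split=> //; exact: chart_inv_dom.
  + exact: transition_smooth.
  + apply: Ck_sum => // i; apply: CkZ => //.
      apply: (Ck_linear_comp oT' (@row_coord_continuous R m i)).
      by apply: (Ck_sub _ (Gs k)) => y [q [cq _] <-]; exact: chart_cod_in.
    by have [_ +] := transition_smooth ac ac' k.+1; exact.
Qed.

End ExtendByZero.

Lemma chart_bump c p : chart_dom c p ->
  exists (K : set M) (f : 'rV[R]_m -> R),
    [/\ closed K, K `<=` chart_dom c, smooth_on (chart_cod c) f,
        f (c p) != 0 & supported c K f].
Proof.
move=> cp.
have /nbhs_ballP[r r0 rB] : nbhs (c p) (chart_cod c).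
  by apply: open_nbhs_nbhs; split; [exact: chart_cod_open|exact: chart_cod_in].
(* Only the open ball of radius [r] is known to lie in [chart_cod]; halving the radius makes the
   closed ball fit. *)
have r20 : 0 < r / 2 by rewrite divr_gt0.
have [f [fs fp f0]] := bump_exists (c p) r20.
have BB : closed_ball (c p) (r / 2) `<=` chart_cod c.
  apply: subset_trans rB; apply: closed_ball_subset => //.
  by rewrite ltr_pdivrMr// ltr_pMr// ltr1n.
exists (chart_inv c @` closed_ball (c p) (r / 2)), f; split.
(* The closed ball is compact, hence so is its image under [chart_inv], and compact sets are closed
   in a Hausdorff space. *)
- apply: compact_closed; first exact: manifold_hausdorff.
  apply: continuous_compact.
    exact: continuous_subspaceW BB (@chart_inv_continuous _ _ _ c).
  apply: bounded_closed_compact; last exact: closed_ball_closed.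
  exists (`|c p| + r / 2); split; first exact: num_real.
  move=> M0 M0r x; rewrite /= closed_ballE// /closed_ball_ /= => xB.
  apply: le_trans (ltW M0r); rewrite -[x](subrK (c p)) addrC.
  by apply: le_trans (ler_normD _ _) _; rewrite lerD2l distrC.
- by move=> _ [x /BB cx <-]; exact: chart_inv_dom.
- by move=> k; apply: Ck_sub (fs k).
- by [].
- move=> q cq nq; apply: f0 => Bq; apply: nq.
  by exists (c q) => //; rewrite chart_mapK.
Qed.

End Charts.

(** * Symplectic linear algebra *)

Section SymplecticAlgebra.
Variables (R : realType) (V : vectType R) (n : nat) (w : V -> V -> R).
Hypothesis w_linear_l : forall v, scalar (fun u => w u v).
Hypothesis w_linear_r : forall u, scalar (fun v => w u v).
Hypothesis w_alternating : forall u, w u u = 0.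
Implicit Types e : 'I_(n + n) -> V.

Lemma scalar_sum (f : V -> R) (I : Type) (r : seq I) (a : I -> R) (x : I -> V) :
  scalar f -> f (\sum_(i <- r) a i *: x i) = \sum_(i <- r) a i * f (x i).
Proof.
move=> lf; elim: r => [|i r IH]; last by rewrite !big_cons lf IH.
by rewrite !big_nil; have := lf (-1) 0 0; rewrite scaler0 addr0 mulN1r addNr.
Qed.

Lemma form_skew u v : w u v = - w v u.
Proof.
apply/eqP; rewrite -addr_eq0; apply/eqP.
have := w_alternating (u + v).
have add_l x y z : w (x + y) z = w x z + w y z.
  by have := w_linear_l z 1 x y; rewrite scale1r mul1r.
have add_r x y z : w z (x + y) = w z x + w z y.
  by have := w_linear_r z 1 x y; rewrite scale1r mul1r.
by rewrite add_l !add_r !w_alternating addr0 add0r.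
Qed.

Lemma ord_halves (P : 'I_(n + n) -> Prop) :
  (forall i, P (lshift n i)) -> (forall i, P (rshift n i)) -> forall i, P i.
Proof. by move=> Pl Pr i; case: (split_ordP i) => j ->. Qed.

(** The basis dual to [e] under [w]; the sign in the second half comes from skewness. *)
Definition dual e (a : 'I_(n + n)) : V :=
  match fintype.split a with
  | inl i => e (rshift n i)
  | inr i => - e (lshift n i)
  end.

Lemma dual_lshift e i : dual e (lshift n i) = e (rshift n i).
Proof. by rewrite /dual (unsplitK (inl i)). Qed.

Lemma dual_rshift e i : dual e (rshift n i) = - e (lshift n i).
Proof. by rewrite /dual (unsplitK (inr i)). Qed.

Lemma scalarN (f : V -> R) x : scalar f -> f (- x) = - f x.
Proof.
move=> lf; have := lf (-1) x 0; rewrite addr0 scaleN1r mulN1r => ->.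
by have := lf (-1) 0 0; rewrite scaler0 addr0 mulN1r addNr => ->; rewrite addr0.
Qed.

Lemma w_dual e a b : symplectic_basis w e -> w (e a) (dual e b) = (a == b)%:R.
Proof.
move=> [_ lr ll rr]; elim/ord_halves: a => i; elim/ord_halves: b => j.
- by rewrite dual_lshift lr eq_lshift.
- by rewrite dual_rshift (scalarN _ (w_linear_r _)) ll oppr0 eq_lrshift.
- by rewrite dual_lshift rr eq_rlshift.
- rewrite dual_rshift (scalarN _ (w_linear_r _)) form_skew opprK lr eq_rshift.
  by rewrite eq_sym.
Qed.

Lemma symplectic_basis_expand e u :
  symplectic_basis w e -> u = \sum_a w u (dual e a) *: e a.
Proof.
move=> se; have [be _ _ _] := se.
have [c ->] : exists c : 'I_(n + n) -> R, u = \sum_a c a *: e a.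
  have : u \in <<[seq e i | i : 'I_(n + n)]>>%VS.
    by have /andP[/eqP -> _] := be; exact: memvf.
  have sz : size [seq e i | i : 'I_(n + n)] = (n + n)%N.
    by rewrite size_map -cardE card_ord.
  pose t := Tuple (introT eqP sz).
  move=> /(@coord_span _ _ _ t) ->; exists (fun a => coord t a u).
  apply: eq_bigr => a _; congr (_ *: _).
  by rewrite (nth_map a) -?cardE ?card_ord// nth_ord_enum.
apply: eq_bigr => a _; congr (_ *: _).
rewrite (scalar_sum _ _ _ (w_linear_l _)) (bigD1 a)//= w_dual// eqxx mulr1.
by rewrite big1 ?addr0// => b ba; rewrite w_dual// (negbTE ba) mulr0.
Qed.

Lemma symplectic_basis_dual_expand e u :
  symplectic_basis w e -> u = \sum_a w (e a) u *: dual e a.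
Proof.
move=> se; rewrite {1}(symplectic_basis_expand u se) !big_split_ord/= addrC.
congr (_ + _); apply: eq_bigr => i _.
- by rewrite dual_rshift dual_lshift (scalarN _ (w_linear_r _)) form_skew opprK.
- by rewrite dual_rshift dual_lshift form_skew scalerN scaleNr.
Qed.

(** * Invariance of the contraction under change of symplectic basis *)

Section Contraction.
Variable B : V -> V -> R.
Hypothesis B_linear_l : forall v, scalar (fun u => B u v).
Hypothesis B_linear_r : forall u, scalar (fun v => B u v).

(** The sum is the trace of [B] against the inverse of [w]. After expanding [e' a] in [e] and
    exchanging sums, the coefficients regroup the vectors [dual e' a] into [dual e b]. *)
Lemma contraction_basis_indep e e' :
  symplectic_basis w e -> symplectic_basis w e' ->
  \sum_a B (e a) (dual e a) = \sum_a B (e' a) (dual e' a).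
Proof.
move=> se se'; apply/esym.
transitivity (\sum_a \sum_b w (e' a) (dual e b) * B (e b) (dual e' a)).
  apply: eq_bigr => a _; rewrite {1}(symplectic_basis_expand (e' a) se).
  exact: (scalar_sum _ _ _ (B_linear_l _)).
rewrite exchange_big/=; apply: eq_bigr => b _.
rewrite -(scalar_sum _ _ _ (B_linear_r _)).
by rewrite -symplectic_basis_dual_expand.
Qed.

(** Links the half sum defining [t12] to the full sum, the one that is visibly invariant; by
    skewness both halves agree. *)
Lemma contractionE e : (forall u v, B u v = - B v u) ->
  \sum_a B (e a) (dual e a) =
  2 * \sum_(i < n) B (e (lshift n i)) (e (rshift n i)).
Proof.
move=> Bskew; rewrite big_split_ord/= mulr_natl mulr2n.
congr (_ + _); apply: eq_bigr => i _; first by rewrite dual_lshift.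
by rewrite dual_rshift (scalarN _ (B_linear_r _)) Bskew opprK.
Qed.

End Contraction.

(** Needed because [torsion2] quantifies over all symplectic bases, whereas the vector [U] of the
    splitting is built from one. *)
Lemma t12_basis_indep e e' t Z : skew_trilinear t ->
  symplectic_basis w e -> symplectic_basis w e' -> t12 e t Z = t12 e' t Z.
Proof.
move=> [tl tm _ ts] se se'.
have cE x : \sum_a t (x a) (dual x a) Z = 2 * t12 x t Z.
  exact: (@contractionE (fun u v => t u v Z) (fun u => tm u Z)).
have := @contraction_basis_indep (fun u v => t u v Z) (fun v => tl v Z)
  (fun u => tm u Z) e e' se se'.
by rewrite !cE => /mulfI; apply; rewrite pnatr_eq0.
Qed.

(** The vector representing [f] through [w] has the values [f (e a)] as coefficients in the dual
    basis. *)
Lemma form_representation e (f : V -> R) : symplectic_basis w e -> scalar f ->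
  exists U, forall Z, w Z U = f Z.
Proof.
move=> se lf; exists (\sum_a f (e a) *: dual e a) => Z.
rewrite (scalar_sum _ _ _ (w_linear_r _)).
rewrite {2}(symplectic_basis_expand Z se) (scalar_sum _ _ _ lf).
by apply: eq_bigr => a _; rewrite mulrC.
Qed.

Definition torsion1_of (U : V) (X Y Z : V) : R :=
  2 * w X Y * w Z U + w X Z * w Y U - w Y Z * w X U.

Lemma torsion1_of_skew_trilinear U : skew_trilinear (torsion1_of U).
Proof.
split; rewrite /torsion1_of.
- by move=> Y Z a u v /=; rewrite !w_linear_l; ring.
- by move=> X Z a u v /=; rewrite w_linear_r !w_linear_l; ring.
- by move=> X Y a u v /=; rewrite w_linear_l !w_linear_r; ring.
- by move=> X Y Z; rewrite (form_skew Y X); ring.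
Qed.

(** Each product such as [w X Y * w Z U] occurs three times, with coefficients 2, -1 and -1. *)
Lemma torsion1_of_cyclic U X Y Z :
  torsion1_of U X Y Z + torsion1_of U Y Z X + torsion1_of U Z X Y = 0.
Proof.
rewrite /torsion1_of (form_skew Y X) (form_skew Z X) (form_skew Z Y); ring.
Qed.

(** Each of the [n] pairs contributes [2 * w Z U] through the first term. The other two terms sum to
    the expansion of [Z] in [e] paired with [U], which adds one more [w Z U]. *)
Lemma t12_torsion1_of e U Z : symplectic_basis w e ->
  t12 e (torsion1_of U) Z = (n.*2.+1)%:R * w Z U.
Proof.
move=> se; have [_ lr _ _] := se.
rewrite /t12 /torsion1_of -mulr_natl.
under eq_bigr do rewrite lr eqxx mulr1 -addrA.
rewrite big_split/= sumr_const card_ord -mulr_natl.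
suff -> : \sum_(i < n) (w (e (lshift n i)) Z * w (e (rshift n i)) U
    - w (e (rshift n i)) Z * w (e (lshift n i)) U) = w Z U.
  have -> : n.*2.+1%:R = 2 * n%:R + 1 :> R by rewrite -natr1 -mul2n natrM.
  by ring.
rewrite {3}(symplectic_basis_expand Z se) (scalar_sum _ _ _ (w_linear_l _)).
rewrite big_split_ord/= big_split/= addrC.
congr (_ + _); apply: eq_bigr => i _.
- by rewrite dual_lshift form_skew mulNr opprK.
- by rewrite dual_rshift (scalarN _ (w_linear_r _)) -form_skew.
Qed.

Lemma torsion12_cyclic t X Y Z :
  torsion12 n w t -> t X Y Z + t Y Z X + t Z X Y = 0.
Proof.
move=> [t1 [t2 [[_ [U t1E]] [_ t2c _] tE]]].
have := torsion1_of_cyclic U X Y Z; rewrite /torsion1_of -!t1E !tE.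
by have := t2c X Y Z; lra.
Qed.

(* Without any symplectic basis, the vanishing of [t12] required in [torsion2]
   is vacuous, so the existence of such a basis is not needed. *)
Lemma cyclic_torsion12 t : skew_trilinear t ->
  (forall X Y Z, t X Y Z + t Y Z X + t Z X Y = 0) -> torsion12 n w t.
Proof.
move=> st tc.
have [U UE] : exists U, forall e, symplectic_basis w e ->
    forall Z, t12 e t Z = (n.*2.+1)%:R * w Z U.
  have [[e se]|ne] := pselect (exists e, symplectic_basis w e); last first.
    by exists 0 => e se; exfalso; apply: ne; exists e.
  have lt : scalar (fun Z => (n.*2.+1)%:R^-1 * t12 e t Z).
    move=> a u v; rewrite /t12 /=; have [_ _ tr _] := st.
    under eq_bigr do rewrite tr.
    by rewrite big_split/= -mulr_sumr mulrDr mulrCA.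
  have [U UE] := form_representation se lt; exists U => e' se' Z.
  rewrite UE mulrA divff ?pnatr_eq0// mul1r.
  exact: t12_basis_indep.
have s1 := torsion1_of_skew_trilinear U.
exists (torsion1_of U), (fun X Y Z => t X Y Z - torsion1_of U X Y Z); split.
- by split => //; exists U.
- split.
  + case: st => [a b c d]; case: s1 => [a1 b1 c1 d1]; split.
    * by move=> Y Z k u v /=; rewrite a a1; ring.
    * by move=> Y Z k u v /=; rewrite b b1; ring.
    * by move=> Y Z k u v /=; rewrite c c1; ring.
    * by move=> X Y Z; rewrite d d1; ring.
  + move=> X Y Z; have := tc X Y Z; have := torsion1_of_cyclic U X Y Z; lra.
  + move=> e se Z; rewrite /t12 sumrB.
    have := UE e se Z; rewrite -(t12_torsion1_of U Z se) /t12 => ->.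
    by rewrite subrr.
- by move=> X Y Z; rewrite addrC subrK.
Qed.

End SymplecticAlgebra.

(** * Torsion of a linear connection *)

Section VectorFields.
Variables (R : realType) (m : nat) (M : manifold R m).
Implicit Types (c : chart R M m) (p : M) (X Y Z : vector_field M).

Lemma to_chartD c p (u v : tangent p) :
  to_chart c (u + v) = to_chart c u + to_chart c v.
Proof. exact: linearD. Qed.

Lemma to_chartZ c p (a : R) (u : tangent p) :
  to_chart c (a *: u) = a *: to_chart c u.
Proof. exact: linearZ. Qed.

Lemma of_chartZ c p (a : R) v : of_chart c p (a *: v) = a *: of_chart c p v.
Proof. exact: linearZ. Qed.

Lemma of_chart_sum c p (I : Type) (r : seq I) (F : I -> 'rV[R]_m) :
  of_chart c p (\sum_(i <- r) F i) = \sum_(i <- r) of_chart c p (F i).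
Proof. exact: linear_sum. Qed.

Lemma local_field_chart c X p : chart_dom c p ->
  local_field c X (c p) = to_chart c (X p).
Proof. by move=> cp; rewrite /local_field (chart_mapK cp). Qed.

Lemma smooth_vfD X Y : smooth_vf X -> smooth_vf Y ->
  smooth_vf (fun p => X p + Y p).
Proof.
move=> sX sY c ac k.
apply: (@Ck_ext _ _ _ _ _ (fun x => local_field c X x + local_field c Y x)).
- exact: chart_cod_open.
- by move=> x _; rewrite /local_field to_chartD.
- by apply: CkD; [exact: chart_cod_open|exact: sX|exact: sY].
Qed.

Lemma smooth_vfZ (f : M -> R) X : smooth_fun f -> smooth_vf X ->
  smooth_vf (fun p => f p *: X p).
Proof.
move=> sf sX c ac k.
apply: (@Ck_ext _ _ _ _ _
  (fun x => (f \o chart_inv c) x *: local_field c X x)).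
- exact: chart_cod_open.
- by move=> x _; rewrite /local_field to_chartZ.
- by apply: CkZ; [exact: chart_cod_open|exact: sf|exact: sX].
Qed.

Lemma smooth_fun_cst (a : R) : smooth_fun (fun _ : M => a).
Proof. by move=> c ac k; exact: Ck_cst. Qed.

Lemma smooth_vf0 : smooth_vf (fun p : M => 0 : tangent p).
Proof.
move=> c ac k; apply: (@Ck_ext _ _ _ _ _ (fun=> 0)).
- exact: chart_cod_open.
- by move=> x _; rewrite /local_field to_chart0.
- exact: Ck_cst.
Qed.

Lemma smooth_vf_sum (I : Type) (r : seq I) (X : I -> vector_field M) :
  (forall i, smooth_vf (X i)) -> smooth_vf (fun p => \sum_(i <- r) X i p).
Proof.
move=> sX; elim: r => [|i r IH].
  have -> : (fun p : M => \sum_(i <- [::]) X i p) = (fun p => 0 : tangent p).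
    by apply: functional_extensionality_dep => p; rewrite big_nil.
  exact: smooth_vf0.
have -> : (fun p : M => \sum_(i <- i :: r) X i p) =
    (fun p => X i p + \sum_(i <- r) X i p).
  by apply: functional_extensionality_dep => p; rewrite big_cons.
exact: smooth_vfD.
Qed.

Lemma local_field_differentiable c X p : atlas c -> chart_dom c p ->
  smooth_vf X -> differentiable (local_field c X) (c p).
Proof.
by move=> ac cp sX; have [+ _] := sX c ac 1; apply; exact: chart_cod_in.
Qed.

Lemma smooth_fun_differentiable c (f : M -> R) p : atlas c -> chart_dom c p ->
  smooth_fun f -> differentiable (f \o chart_inv c) (c p).
Proof.
by move=> ac cp sf; have [+ _] := sf c ac 1; apply; exact: chart_cod_in.
Qed.

Lemma lieE X Y p : let c := chart_at p in
  lie X Y p = 'D_(to_chart c (X p)) (local_field c Y) (c p) -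
              'D_(to_chart c (Y p)) (local_field c X) (c p).
Proof. by rewrite unlock. Qed.

Lemma lie_skew X Y p : lie X Y p = - lie Y X p.
Proof. by rewrite unlock opprB. Qed.

Lemma lieDl X X' Y p : smooth_vf X -> smooth_vf X' -> smooth_vf Y ->
  lie (fun q => X q + X' q) Y p = lie X Y p + lie X' Y p.
Proof.
move=> sX sX' sY; rewrite !lieE.
have [ac cp] := (chart_at_atlas p, chart_at_dom p).
set c := chart_at p in ac cp *.
have dX := local_field_differentiable ac cp sX.
have dX' := local_field_differentiable ac cp sX'.
have dY := local_field_differentiable ac cp sY.
have -> : local_field c (fun q => X q + X' q) =
    local_field c X + local_field c X'.
  by apply/funext => x; rewrite /local_field to_chartD.
rewrite to_chartD !(deriveE _ dY) linearD.
rewrite (deriveD (diff_derivable dX) (diff_derivable dX')).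
by rewrite opprD addrACA.
Qed.

Lemma lieZl (f : M -> R) X Y p : smooth_fun f -> smooth_vf X -> smooth_vf Y ->
  lie (fun q => f q *: X q) Y p = f p *: lie X Y p - vf_act Y f p *: X p.
Proof.
move=> sf sX sY; rewrite !lieE.
have [ac cp] := (chart_at_atlas p, chart_at_dom p).
rewrite /vf_act.
set c := chart_at p in ac cp *.
have dX := local_field_differentiable ac cp sX.
have dY := local_field_differentiable ac cp sY.
have df := smooth_fun_differentiable ac cp sf.
have -> : local_field c (fun q => f q *: X q) =
    (fun x => (f \o chart_inv c) x *: local_field c X x).
  by apply/funext => x; rewrite /local_field to_chartZ.
rewrite to_chartZ !(deriveE _ dY) [in LHS]linearZ (derive_scale _ df dX).
rewrite (local_field_chart X cp) !(to_chart_at (X p)) !(to_chart_at (Y p)) /=.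
by rewrite (chart_mapK cp) scalerBr opprD addrCA addrC.
Qed.

Section Torsion.
Variable nabla : linear_connection M.

Lemma torsion_skew X Y p : torsion nabla X Y p = - torsion nabla Y X p.
Proof. by rewrite /torsion (lie_skew X Y) !opprB opprK addrC. Qed.

Lemma torsionDl X X' Y p : smooth_vf X -> smooth_vf X' -> smooth_vf Y ->
  torsion nabla (fun q => X q + X' q) Y p =
  torsion nabla X Y p + torsion nabla X' Y p.
Proof.
move=> sX sX' sY; rewrite /torsion lieDl// cov_addl// cov_addr//.
by rewrite !opprD (addrACA (nabla X Y p)) [LHS]addrACA.
Qed.

(** The term [vf_act Y f p *: X p] arises from the Leibniz rule for [nabla Y] and again, with
    opposite sign, from the bracket. *)
Lemma torsionZl (f : M -> R) X Y p :
  smooth_fun f -> smooth_vf X -> smooth_vf Y ->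
  torsion nabla (fun q => f q *: X q) Y p = f p *: torsion nabla X Y p.
Proof.
move=> sf sX sY; rewrite /torsion lieZl// cov_scalel// cov_leibniz//.
by rewrite !scalerBr opprD opprB !addrA; congr (_ - _); rewrite addrAC addrNK.
Qed.

Lemma torsion_suml (I : Type) (r : seq I) (X : I -> vector_field M) Y p :
  (forall i, smooth_vf (X i)) -> smooth_vf Y ->
  torsion nabla (fun q => \sum_(i <- r) X i q) Y p =
  \sum_(i <- r) torsion nabla (X i) Y p.
Proof.
move=> sX sY; elim: r => [|i r IH].
  rewrite big_nil.
  (* Writing the zero field as the zero function times a field reduces the empty sum to
     homogeneity. *)
  have -> : (fun q : M => \sum_(i <- [::]) X i q) =
      (fun q => (fun=> 0) q *: (0 : tangent q)).
    by apply: functional_extensionality_dep => q; rewrite big_nil scale0r.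
  rewrite torsionZl ?scale0r//; [exact: smooth_fun_cst|exact: smooth_vf0].
have -> : (fun q : M => \sum_(i <- i :: r) X i q) =
    (fun q => X i q + \sum_(i <- r) X i q).
  by apply: functional_extensionality_dep => q; rewrite big_cons.
by rewrite big_cons -IH torsionDl//; exact: smooth_vf_sum.
Qed.

(* With a bump function [f] and the coordinate fields [E i] cut off by [f],
   [f ^ 2 X] is the combination of the global fields [E i] with coefficients
   [f X^i], which vanish at [p]. *)
Lemma torsion_eq0l X Y p : smooth_vf X -> smooth_vf Y -> X p = 0 ->
  torsion nabla X Y p = 0.
Proof.
move=> sX sY Xp0; have [ac cp] := (chart_at_atlas p, chart_at_dom p).
set c := chart_at p in ac cp *.
have [K [f [cK Kc fs fp fK]]] := chart_bump cp.
pose E i := extend_vf c (fun z => f z *: (delta_mx 0 i : 'rV[R]_m)).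
pose a i := extend_fun c (fun z => f z *: row_coord i (local_field c X z)).
pose f2 := extend_fun c (fun z => f z *: f z).
have oc := @chart_cod_open _ _ _ c.
have sE i : smooth_vf (E i).
  apply: (extend_vf_smooth ac cK Kc).
    by move=> k; apply: CkZ; [exact: oc|exact: fs|exact: Ck_cst].
  by move=> q cq nq; rewrite fK// scale0r.
have sa i : smooth_fun (a i).
  apply: (extend_fun_smooth ac cK Kc).
    move=> k; apply: CkZ; [exact: oc|exact: fs|].
    by apply: (Ck_linear_comp oc (@row_coord_continuous R m i)); exact: sX.
  by move=> q cq nq; rewrite fK// scale0r.
have sf2 : smooth_fun f2.
  apply: (extend_fun_smooth ac cK Kc).
    by move=> k; apply: CkZ; [exact: oc|exact: fs|exact: fs].
  by move=> q cq nq; rewrite fK// scale0r.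
have XE : (fun q => f2 q *: X q) = (fun q => \sum_i a i q *: E i q).
  apply: functional_extensionality_dep => q.
  have [cq|ncq] := pselect (chart_dom c q); last first.
    rewrite /f2 extend_fun_out// scale0r big1// => i _.
    by rewrite /a extend_fun_out// scale0r.
  rewrite /f2 extend_fun_in// -[in LHS](to_chartK (X q) ac cq).
  rewrite [in LHS](row_sum_delta (to_chart c (X q))) of_chart_sum scaler_sumr.
  apply: eq_bigr => i _; rewrite /a /E extend_fun_in// extend_vf_in//.
  rewrite (local_field_chart X cq) !of_chartZ !scalerA.
  by congr (_ *: _); rewrite /row_coord /GRing.scale/=; ring.
have : f2 p *: torsion nabla X Y p = 0.
  rewrite -torsionZl// XE torsion_suml//; last first.
    by move=> i; apply: smooth_vfZ.
  rewrite big1// => i _; rewrite torsionZl// /a extend_fun_in//.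
  by rewrite (local_field_chart X cp) Xp0 to_chart0 linear0 scaler0 scale0r.
move=> /eqP; rewrite scaler_eq0 /f2 extend_fun_in// => /orP[|/eqP//].
by rewrite mulf_eq0 (negbTE fp).
Qed.

Lemma torsion_eql X X' Y p : smooth_vf X -> smooth_vf X' -> smooth_vf Y ->
  X p = X' p -> torsion nabla X Y p = torsion nabla X' Y p.
Proof.
move=> sX sX' sY XX'.
have sN := smooth_vfZ (@smooth_fun_cst (-1)) sX'.
have D0 : X p + (-1 : R) *: X' p = 0 by rewrite XX' scaleN1r subrr.
have := torsion_eq0l (smooth_vfD sX sN) sY D0.
rewrite torsionDl// torsionZl//; last exact: smooth_fun_cst.
by rewrite scaleN1r => /subr0_eq.
Qed.

Lemma torsion_tensorial X X' Y Y' p :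
  smooth_vf X -> smooth_vf X' -> smooth_vf Y -> smooth_vf Y' ->
  X p = X' p -> Y p = Y' p -> torsion nabla X Y p = torsion nabla X' Y' p.
Proof.
move=> sX sX' sY sY' XX' YY'; rewrite (torsion_eql sX sX' sY XX').
by rewrite torsion_skew (torsion_eql sY sY' sX' YY') -torsion_skew.
Qed.

End Torsion.

(** The field is constant in the preferred chart at [p], cut off by a bump [f] and divided by the
    value of [f] at [p]. *)
Lemma vf_through p (u : tangent p) : exists X, smooth_vf X /\ X p = u.
Proof.
have [ac cp] := (chart_at_atlas p, chart_at_dom p).
have [K [f [cK Kc fs fp fK]]] := chart_bump cp.
have oc := @chart_cod_open _ _ _ (chart_at p).
exists (extend_vf (chart_at p)
  (fun z => f z *: ((f (chart_at p p))^-1 *: (u : 'rV[R]_m)))); split.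
  apply: (extend_vf_smooth ac cK Kc).
    by move=> k; apply: CkZ; [exact: oc|exact: fs|exact: Ck_cst].
  by move=> q cq nq; rewrite fK// scale0r.
by rewrite extend_vf_in// of_chart_at scalerA divff// scale1r.
Qed.

End VectorFields.

(** * The exterior derivative in terms of the torsion tensor *)

Section AlmostSymplectic.
Variables (R : realType) (m : nat) (M : manifold R m).
Variables (omega : two_form M) (nabla : linear_connection M).
Implicit Types (p : M) (X Y Z : vector_field M).

Lemma formB_l p (u v z : tangent p) :
  omega p (u - v) z = omega p u z - omega p v z.
Proof.
rewrite addrC [RHS]addrC -mulN1r -scaleN1r.
exact: (form_linear_l omega z (-1) v u).
Qed.

Lemma two_form_skew p (u v : tangent p) : omega p u v = - omega p v u.
Proof.
apply: form_skew.
- exact: form_linear_l.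
- exact: form_linear_r.
- exact: form_alternating.
Qed.

(** Parallelism turns the three derivatives into six covariant terms; with the three brackets they
    make up exactly the three torsions. *)
Lemma ext_deriv_cyclic_torsion X Y Z p : parallel_form nabla omega ->
  smooth_vf X -> smooth_vf Y -> smooth_vf Z ->
  ext_deriv omega X Y Z p = omega p (torsion nabla X Y p) (Z p)
    + omega p (torsion nabla Y Z p) (X p) + omega p (torsion nabla Z X p) (Y p).
Proof.
move=> par sX sY sZ.
have vE U V W : smooth_vf U -> smooth_vf V -> smooth_vf W ->
    vf_act U (form_fun omega V W) p =
    omega p (nabla U V p) (W p) - omega p (nabla U W p) (V p).
  move=> sU sV sW; have := par U V W sU sV sW p.
  by rewrite /form_fun (two_form_skew (V p)); lra.
rewrite /ext_deriv !vE// /form_fun /torsion !formB_l.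
rewrite (lie_skew Z X) -[- lie X Z p]add0r formB_l.
have -> : omega p 0 (Y p) = 0.
  by have := formB_l 0 0 (Y p); rewrite !subrr.
ring.
Qed.

Lemma torsion_tensor_exists p : exists t,
  torsion_tensor_at nabla omega t /\ @skew_trilinear R (tangent p) t.
Proof.
(* The chosen extension need not be linear in [u]; linearity of [T] holds because torsion at [p]
   sees only values at [p]. *)
pose E (u : tangent p) := projT1 (cid (vf_through u)).
have sE u : smooth_vf (E u) by rewrite /E; case: cid => ? [].
have Ep u : E u p = u by rewrite /E; case: cid => ? [].
pose T (u v : tangent p) := torsion nabla (E u) (E v) p.
have TE X Y : smooth_vf X -> smooth_vf Y ->
    T (X p) (Y p) = torsion nabla X Y p.
  by move=> sX sY; apply: torsion_tensorial.
have Tskew u v : T u v = - T v u by exact: torsion_skew.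
have Tlin v a u u' : T (a *: u + u') v = a *: T u v + T u' v.
  have sa := smooth_vfZ (@smooth_fun_cst R m M a) (sE u).
  rewrite /T -(torsionZl _ _ (@smooth_fun_cst R m M a))//.
  rewrite -torsionDl//; apply: torsion_eql => //; last by rewrite !Ep.
  exact: smooth_vfD.
exists (fun u v z => omega p (T u v) z); split.
  by move=> X Y Z sX sY sZ; rewrite TE.
split.
- by move=> v z a u u' /=; rewrite Tlin form_linear_l.
- move=> u z a v v' /=; rewrite Tskew Tlin opprD -scalerN -!Tskew.
  by rewrite form_linear_l.
- by move=> u v a z z' /=; rewrite form_linear_r.
- move=> u v z; rewrite Tskew -[- T v u]add0r formB_l.
  by have := formB_l 0 0 z; rewrite !subrr => ->; rewrite add0r.
Qed.

End AlmostSymplectic.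

Theorem theorem6p2 (R : realType) (n : nat) (M : manifold R (n + n))
    (omega : two_form M) (nabla : linear_connection M)
    (omega_nondegenerate : nondegenerate_form omega)
    (nabla_AS : AS_connection omega nabla) :
  closed_form omega <->
  (forall p : M, exists t : tangent p -> tangent p -> tangent p -> R,
     torsion_tensor_at nabla omega t /\ torsion12 n (omega p) t).
Proof.
have [_ _ par] := nabla_AS; split=> [closed p|H X Y Z sX sY sZ p].
- have [t [tT st]] := torsion_tensor_exists omega nabla p.
  exists t; split => //; apply: cyclic_torsion12 => //.
  + by move=> v; exact: form_linear_l.
  + by move=> u; exact: form_linear_r.
  + exact: form_alternating.
  + move=> u v z.
    (* Closedness is a condition on global fields, so the tangent vectors are realised as values of
       such fields. *)
    have [X [sX <-]] := vf_through u.
    have [Y [sY <-]] := vf_through v.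
    have [Z [sZ <-]] := vf_through z.
    by rewrite !tT// -ext_deriv_cyclic_torsion// closed.
- have [t [tT t12]] := H p.
  rewrite (ext_deriv_cyclic_torsion _ par)// -!tT//.
  apply: (torsion12_cyclic _ _ _ _ _ _ t12).
  + exact: form_linear_l.
  + exact: form_linear_r.
  + exact: form_alternating.
Qed.
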